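(* Let $(A,\mu,\eta,\Delta,\epsilon,\alpha,\Phi)$ be an HQ-bialgebra over a field $\mathbb{K}$ and let $\beta:A\to A$ be an HQ-bialgebra morphism. Then $(A,\ \mu_\beta=\beta\circ\mu,\ \eta,\ \Delta_\beta=\Delta\circ\beta,\ \epsilon,\ \beta\circ\alpha,\ \Phi)$ is an HQ-bialgebra. In particular, if $(A,\mu,\eta,\Delta,\epsilon,\Phi)$ is a quasi-bialgebra and $\beta:A\to A$ is a quasi-bialgebra morphism, then $(A,\ \beta\circ\mu,\ \eta,\ \Delta\circ\beta,\ \epsilon,\ \beta,\ \Phi)$ is an HQ-bialgebra.
   Context: $\mathbb{K}$ is a field; all maps are $\mathbb{K}$-linear. A unital Hom-associative algebra $(A,\mu,\alpha,\eta)$ is a $\mathbb{K}$-vector space $A$ with linear maps $\mu:A\otimes A\to A$ (written $xy=\mu(x\otimes y)$), $\alpha:A\to A$, $\eta:\mathbb{K}\to A$ (put $1_A=\eta(1_{\mathbb{K}})$) such that $(xy)\alpha(z)=\alpha(x)(yz)$ and $x1_A=1_Ax=\alpha(x)$ for all $x,y,z\in A$. Tensor powers $A^{\otimes n}$ carry the componentwise multiplication, the twist $\alpha^{\otimes n}$ and the unit element $1_A^{\otimes n}$. An element $x$ is invertible if there is $x^{-1}$ with $xx^{-1}=x^{-1}x=1$. A Hom-algebra morphism is a linear map that preserves products, commutes with the twist maps and preserves units; $\mathbb{K}$ has identity twist. A Hom-quasi-bialgebra (HQ-bialgebra) is a tuple $(A,\mu,\eta,\Delta,\epsilon,\alpha,\Phi)$,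 where $\Phi\in A^{\otimes 3}$ is invertible with $\alpha^{\otimes 3}(\Phi)=\Phi$, such that: (1) $(A,\mu,\alpha,\eta)$ is a unital Hom-associative algebra; (2) $\Delta:A\to A\otimes A$ is a Hom-algebra morphism, i.e. $\Delta\circ\alpha=\alpha^{\otimes2}\circ\Delta$ and $\Delta(xy)=\Delta(x)\Delta(y)$; (3) $\epsilon:A\to\mathbb{K}$ is a Hom-algebra morphism, i.e. $\epsilon(\alpha(x))=\epsilon(x)$ and $\epsilon(xy)=\epsilon(x)\epsilon(y)$; (4) for all $x\in A$, $(\alpha\otimes\Delta)(\Delta(x))\,\Phi=\Phi\,(\Delta\otimes\alpha)(\Delta(x))$; $(\epsilon\otimes id)(\Delta(x))=\alpha(x)=(id\otimes\epsilon)(\Delta(x))$; $(\alpha\otimes\alpha\otimes\Delta)(\Phi)\,(\Delta\otimes\alpha\otimes\alpha)(\Phi)=\Phi_{(234)}\,(\alpha\otimes\Delta\otimes\alpha)(\Phi)\,\Phi_{(123)}$; $(id\otimes\epsilon\otimes id)(\Phi)=1_A\otimes1_A$; where $\Phi_{(123)}=\Phi\otimes1_A$ and $\Phi_{(234)}=1_A\otimes\Phi$ (the placement of parentheses in the triple product is immaterial because $\alpha^{\otimes3}(\Phi)=\Phi$). An HQ-bialgebra morphism $f:(A,\mu,\eta,\Delta,\epsilon,\alpha,\Phi)\to(A',\mu',\eta',\Delta',\epsilon',\alpha',\Phi')$ is a linear map with $f\circ\mu=\mu'\circ(f\otimes f)$, $f(1_A)=1_{A'}$, $(f\otimes f)\circ\Delta=\Delta'\circ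 f$, $\epsilon'\circ f=\epsilon$, $f\circ\alpha=\alpha'\circ f$, $f^{\otimes3}(\Phi)=\Phi'$. A quasi-bialgebra (resp. quasi-bialgebra morphism) is an HQ-bialgebra with $\alpha=id$ (resp. an HQ-bialgebra morphism between such). *)

(* Defs.v *)
From HB Require Import structures.
From mathcomp Require Import all_boot all_algebra.
From mathcomp Require Import boolp.

Set Implicit Arguments.
Unset Strict Implicit.
Unset Printing Implicit Defensive.

Import GRing.Theory.
Local Open Scope ring_scope.
Local Open Scope quotient_scope.

(* Tensor product of two K-vector spaces of arbitrary dimension.  The sequence
   [:: (u_1, v_1); ..; (u_n, v_n)] stands for the formal sum of the pure tensors
   u_i (x) v_i; formal sums are identified by the additive congruence generated
   by the bilinearity relations.  The universal property is tliftE together with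
   tensor_ext below. *)
Section Tensor.
Variables (K : fieldType) (U V : lmodType K).

Inductive tensor_rel : seq (U * V) -> seq (U * V) -> Prop :=
| TensorRefl s : tensor_rel s s
| TensorSym s t : tensor_rel s t -> tensor_rel t s
| TensorTrans s t r : tensor_rel s t -> tensor_rel t r -> tensor_rel s r
| TensorCat s s' t t' :
    tensor_rel s s' -> tensor_rel t t' -> tensor_rel (s ++ t) (s' ++ t')
| TensorComm s t : tensor_rel (s ++ t) (t ++ s)
| TensorZero v : tensor_rel [:: (0, v)] [::]
| TensorAddl u u' v : tensor_rel [:: (u + u', v)] [:: (u, v); (u', v)]
| TensorAddr u v v' : tensor_rel [:: (u, v + v')] [:: (u, v); (u, v')]
| TensorScale (k : K) u v : tensor_rel [:: (k *: u, v)] [:: (u, k *: v)].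

Definition tensor_relb (s t : seq (U * V)) : bool := `[< tensor_rel s t >].

Lemma tensor_relb_refl : reflexive tensor_relb.
Proof. by move=> s; apply/asboolP; exact: TensorRefl. Qed.

Lemma tensor_relb_sym : symmetric tensor_relb.
Proof. by move=> s t; apply/asboolP/asboolP; exact: TensorSym. Qed.

Lemma tensor_relb_trans : transitive tensor_relb.
Proof.
move=> s t r /asboolP ts /asboolP sr; apply/asboolP.
exact: TensorTrans ts sr.
Qed.

Canonical tensor_equiv :=
  EquivRel tensor_relb tensor_relb_refl tensor_relb_sym tensor_relb_trans.

Definition tensor := {eq_quot tensor_equiv}.
HB.instance Definition _ := Choice.on tensor.
HB.instance Definition _ := EqQuotient.on tensor.

Lemma tensor_quotW (P : tensor -> Prop) :
  (forall s, P (\pi_tensor s)) -> forall x, P x.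
Proof. by move=> Ppi x; rewrite -[x]reprK; exact: Ppi. Qed.

Lemma tensor_eqP s t : reflect (tensor_rel s t) (\pi_tensor s == \pi_tensor t).
Proof. by rewrite eqmodE; exact: asboolP. Qed.

Lemma tensor_eq s t : tensor_rel s t -> \pi_tensor s = \pi_tensor t.
Proof. by move=> /tensor_eqP/eqP. Qed.

Lemma tensor_repr s : tensor_rel (repr (\pi_tensor s)) s.
Proof. by apply/tensor_eqP; rewrite reprK. Qed.

Definition formal_scale (k : K) (s : seq (U * V)) : seq (U * V) :=
  [seq (k *: p.1, p.2) | p <- s].

Lemma formal_scale_rel k s t :
  tensor_rel s t -> tensor_rel (formal_scale k s) (formal_scale k t).
Proof.
elim=> {s t} [s|s t _ IH|s t r _ IH1 _ IH2|s s' t t' _ IH1 _ IH2|s t|v|u u' v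
  |u v v'|l u v] /=.
- exact: TensorRefl.
- exact: TensorSym.
- exact: TensorTrans IH1 IH2.
- by rewrite /formal_scale !map_cat; exact: TensorCat.
- by rewrite /formal_scale !map_cat; exact: TensorComm.
- by rewrite scaler0; exact: TensorZero.
- by rewrite scalerDr; exact: TensorAddl.
- exact: TensorAddr.
- by rewrite scalerA mulrC -scalerA; exact: TensorScale.
Qed.

Definition tensor_add (x y : tensor) : tensor := \pi_tensor (repr x ++ repr y).
Definition tensor_zero : tensor := \pi_tensor [::].
Definition tensor_scale (k : K) (x : tensor) : tensor :=
  \pi_tensor (formal_scale k (repr x)).
Definition tensor_opp (x : tensor) : tensor := tensor_scale (-1) x.

Lemma tensor_addE s t :
  tensor_add (\pi_tensor s) (\pi_tensor t) = \pi_tensor (s ++ t).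
Proof. by apply: tensor_eq; apply: TensorCat; exact: tensor_repr. Qed.

Lemma tensor_scaleE k s :
  tensor_scale k (\pi_tensor s) = \pi_tensor (formal_scale k s).
Proof. by apply: tensor_eq; apply: formal_scale_rel; exact: tensor_repr. Qed.

Lemma tensor_addA : associative tensor_add.
Proof.
move=> x y z; elim/tensor_quotW: x => x; elim/tensor_quotW: y => y.
by elim/tensor_quotW: z => z; rewrite !tensor_addE catA.
Qed.

Lemma tensor_addC : commutative tensor_add.
Proof.
move=> x y; elim/tensor_quotW: x => x; elim/tensor_quotW: y => y.
rewrite !tensor_addE.
exact/tensor_eq/TensorComm.
Qed.

Lemma tensor_add0 : left_id tensor_zero tensor_add.
Proof. by move=> x; elim/tensor_quotW: x => x; rewrite tensor_addE. Qed.

Lemma formal_scaleDl k l s :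
  tensor_rel (formal_scale (k + l) s) (formal_scale k s ++ formal_scale l s).
Proof.
elim: s => [|[u v] s IH] /=; first exact: TensorRefl.
rewrite scalerDl -cat1s.
apply: (@TensorTrans _ ([:: (k *: u, v); (l *: u, v)]
          ++ (formal_scale k s ++ formal_scale l s))).
  by apply: TensorCat => //; exact: TensorAddl.
apply: (@TensorCat [:: _] [:: _]); first exact: TensorRefl.
rewrite -/(formal_scale k s) -/(formal_scale l s) /= -cat_rcons -cats1.
apply: (@TensorCat (_ :: _)); last exact: TensorRefl.
exact: (@TensorComm [:: _]).
Qed.

Lemma formal_scale0 s : tensor_rel (formal_scale 0 s) [::].
Proof.
elim: s => [|[u v] s IH] /=; first exact: TensorRefl.
rewrite scale0r -cat1s -[X in tensor_rel _ X]cats0.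
by apply: TensorCat => //; exact: TensorZero.
Qed.

Lemma formal_scale1 s : formal_scale 1 s = s.
Proof. by elim: s => [|[u v] s IH] //=; rewrite scale1r IH. Qed.

Lemma tensor_addN : left_inverse tensor_zero tensor_opp tensor_add.
Proof.
move=> x; elim/tensor_quotW: x => x.
rewrite /tensor_opp tensor_scaleE tensor_addE; apply: tensor_eq.
rewrite -[X in _ ++ X]formal_scale1; apply: TensorTrans (formal_scale0 x).
by apply: TensorSym; rewrite -[X in formal_scale X](addNr 1); exact: formal_scaleDl.
Qed.

HB.instance Definition _ := GRing.isZmodule.Build tensor
  tensor_addA tensor_addC tensor_add0 tensor_addN.

Lemma tensor_scaleA k l x :
  tensor_scale k (tensor_scale l x) = tensor_scale (k * l) x.
Proof.
elim/tensor_quotW: x => s; rewrite !tensor_scaleE /formal_scale -map_comp.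
by congr (\pi_tensor _); apply: eq_map => p /=; rewrite scalerA.
Qed.

Lemma tensor_scale1 : left_id 1 tensor_scale.
Proof. by move=> x; elim/tensor_quotW: x => s; rewrite tensor_scaleE formal_scale1. Qed.

Lemma tensor_scaleDr : right_distributive tensor_scale +%R.
Proof.
move=> k x y; elim/tensor_quotW: x => s; elim/tensor_quotW: y => t.
by rewrite /GRing.add /= !(tensor_addE, tensor_scaleE) /formal_scale map_cat.
Qed.

Lemma tensor_scaleDl x : {morph tensor_scale^~ x : k l / k + l}.
Proof.
move=> k l; elim/tensor_quotW: x => s.
rewrite [in RHS]/GRing.add /= !(tensor_addE, tensor_scaleE).
exact/tensor_eq/formal_scaleDl.
Qed.

HB.instance Definition _ := GRing.Zmodule_isLmodule.Build K tensor
  tensor_scaleA tensor_scale1 tensor_scaleDr tensor_scaleDl.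

Definition ten (u : U) (v : V) : tensor := \pi_tensor [:: (u, v)].

Lemma ten_linear_l v : linear (ten^~ v).
Proof.
move=> k u u'; rewrite {2}/ten /GRing.add /GRing.scale /= tensor_scaleE.
by rewrite tensor_addE; apply: tensor_eq; exact: TensorAddl.
Qed.

Lemma ten_linear_r u : linear (ten u).
Proof.
move=> k v v'; rewrite {2}/ten /GRing.add /GRing.scale /= tensor_scaleE.
rewrite tensor_addE; apply: tensor_eq.
apply: TensorTrans (TensorAddr _ _ _) _.
apply: (@TensorCat [:: _] [:: _] [:: _] [:: _]); last exact: TensorRefl.
exact/TensorSym/TensorScale.
Qed.

HB.instance Definition _ :=
  bilinear_isBilinear.Build K U V tensor *:%R *:%R ten
    (ten_linear_l, ten_linear_r).
HB.instance Definition _ u :=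
  GRing.isLinear.Build K V tensor *:%R (ten u) (ten_linear_r u).

End Tensor.

Notation "u \ot v" := (ten u v) (at level 40, left associativity) : ring_scope.

Section TensorTheory.
Variables (K : fieldType) (U V : lmodType K).

Lemma tensor_sum (s : seq (U * V)) :
  \pi_(tensor U V) s = \sum_(p <- s) p.1 \ot p.2.
Proof.
elim: s => [|[u v] s IH]; first by rewrite big_nil.
by rewrite big_cons -IH -cat1s -tensor_addE.
Qed.

Lemma tensor_ind (P : tensor U V -> Prop) :
  P 0 -> (forall u v, P (u \ot v)) -> (forall x y, P x -> P y -> P (x + y)) ->
  forall x, P x.
Proof.
by move=> P0 P1 PD x; elim/tensor_quotW: x => s; rewrite tensor_sum; apply: big_ind.
Qed.

Lemma tensor_ext (W : lmodType K) (f g : {linear tensor U V -> W}) :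
  (forall u v, f (u \ot v) = g (u \ot v)) -> f =1 g.
Proof.
move=> fg; elim/tensor_ind=> [|//|x y fx fy]; first by rewrite !linear0.
by rewrite !linearD fx fy.
Qed.

Section Lift.
Variables (W : lmodType K) (f : {bilinear U -> V -> W}).

Definition tlift (x : tensor U V) : W := \sum_(p <- repr x) f p.1 p.2.

Lemma tlift_rel s t : tensor_rel s t ->
  \sum_(p <- s) f p.1 p.2 = \sum_(p <- t) f p.1 p.2.
Proof.
elim=> {s t} [s|s t _ IH|s t r _ IH1 _ IH2|s s' t t' _ IH1 _ IH2|s t|v|u u' v
  |u v v'|l u v] //=.
- by rewrite IH1.
- by rewrite !big_cat IH1 IH2.
- by rewrite !big_cat /= addrC.
- by rewrite big_seq1 big_nil /= linear0l.
- by rewrite !big_cons !big_nil /= !addr0 linearDl.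
- by rewrite !big_cons !big_nil /= !addr0 linearDr.
- by rewrite !big_cons !big_nil /= !addr0 linearZl_LR linearZr_LR.
Qed.

Lemma tlift_pi s : tlift (\pi_(tensor U V) s) = \sum_(p <- s) f p.1 p.2.
Proof. by apply: tlift_rel; exact: tensor_repr. Qed.

Lemma tlift_linear : linear tlift.
Proof.
move=> k x y; elim/tensor_quotW: x => s; elim/tensor_quotW: y => t.
rewrite {1}/GRing.add {1}/GRing.scale /= tensor_scaleE tensor_addE !tlift_pi.
rewrite big_cat /= scaler_sumr big_map; congr (_ + _).
by apply: eq_bigr => p _ /=; rewrite linearZl_LR.
Qed.

HB.instance Definition _ := GRing.isLinear.Build K (tensor U V) W *:%R tlift
  tlift_linear.

Lemma tliftE u v : tlift (u \ot v) = f u v.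
Proof. by rewrite tlift_pi big_seq1. Qed.

End Lift.
End TensorTheory.

Section TensorMaps.
Variable K : fieldType.
Implicit Types U V W : lmodType K.

Section Map.
Variables (U V U' V' : lmodType K).
Variables (f : {linear U -> U'}) (g : {linear V -> V'}).

Definition tmap_bil (u : U) (v : V) : tensor U' V' := f u \ot g v.

Lemma tmap_bil_bilinear : bilinear_for *:%R *:%R tmap_bil.
Proof.
by split=> [v k u u'|u k v v']; rewrite /tmap_bil linearP ?linearPl ?linearPr.
Qed.

HB.instance Definition _ := bilinear_isBilinear.Build K U V (tensor U' V')
  *:%R *:%R tmap_bil tmap_bil_bilinear.

Definition tmap : tensor U V -> tensor U' V' := tlift tmap_bil.
HB.instance Definition _ := GRing.Linear.on tmap.

Lemma tmapE u v : tmap (u \ot v) = f u \ot g v.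
Proof. exact: tliftE. Qed.

End Map.

Section Assoc.
Variables U V W : lmodType K.

Definition tassoc_bil (x : tensor U V) (w : W) : tensor U (tensor V W) :=
  tmap idfun (applyr (@ten K V W) w) x.

Lemma tassoc_bil_bilinear : bilinear_for *:%R *:%R tassoc_bil.
Proof.
split=> [w k x x'|x k w w']; rewrite /tassoc_bil; first by rewrite linearP.
elim/tensor_ind: x => [|u v|x y IHx IHy].
- by rewrite !linear0 addr0 /= scaler0.
- by rewrite !tmapE /= !linearPr.
- by rewrite !linearD /= IHx IHy scalerDr addrACA.
Qed.

HB.instance Definition _ := bilinear_isBilinear.Build K (tensor U V) W
  (tensor U (tensor V W)) *:%R *:%R tassoc_bil tassoc_bil_bilinear.

Definition tassoc : tensor (tensor U V) W -> tensor U (tensor V W) :=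
  tlift tassoc_bil.
HB.instance Definition _ := GRing.Linear.on tassoc.

Lemma tassocE u v w : tassoc (u \ot v \ot w) = u \ot (v \ot w).
Proof. by rewrite /tassoc tliftE /= /tassoc_bil tmapE. Qed.

End Assoc.

Section Interchange.
Variables U V U' V' : lmodType K.
Local Notation T := (tensor (tensor U U') (tensor V V')).

Definition tinter_pure (y : tensor U' V') (u : U) (v : V) : T :=
  tmap (@ten K U U' u) (@ten K V V' v) y.

Lemma tinter_pure_bilinear y : bilinear_for *:%R *:%R (tinter_pure y).
Proof.
split=> [v k u u'|u k v v']; rewrite /tinter_pure;
  (elim/tensor_ind: y => [|a b|x y IHx IHy];
    [ by rewrite !linear0 addr0 /= scaler0
    | by rewrite !tmapE /= ?linearPl ?linearPr ?linearPl
    | by rewrite !linearD /= IHx IHy scalerDr addrACA ]).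
Qed.

HB.instance Definition _ y := bilinear_isBilinear.Build K U V T *:%R *:%R
  (tinter_pure y) (tinter_pure_bilinear y).

Definition tinter_bil (x : tensor U V) (y : tensor U' V') : T :=
  tlift (tinter_pure y) x.

Lemma tinter_bil_bilinear : bilinear_for *:%R *:%R tinter_bil.
Proof.
split=> [y k x x'|x k y y']; rewrite /tinter_bil; first by rewrite linearP.
elim/tensor_ind: x => [|u v|x x' IHx IHy].
- by rewrite !linear0 addr0 /= scaler0.
- by rewrite !tliftE /= /tinter_pure linearP.
- by rewrite !linearD /= IHx IHy scalerDr addrACA.
Qed.

HB.instance Definition _ := bilinear_isBilinear.Build K (tensor U V)
  (tensor U' V') T *:%R *:%R tinter_bil tinter_bil_bilinear.

Definition tinter : tensor (tensor U V) (tensor U' V') -> T :=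
  tlift tinter_bil.
HB.instance Definition _ := GRing.Linear.on tinter.

Lemma tinterE u v u' v' :
  tinter ((u \ot v) \ot (u' \ot v')) = (u \ot u') \ot (v \ot v').
Proof. by rewrite /tinter tliftE /= /tinter_bil tliftE /= /tinter_pure tmapE. Qed.

End Interchange.

Section Units.
Variable U : lmodType K.

Definition tunitl_bil (k : K^o) (u : U) : U := k *: u.
Definition tunitr_bil (u : U) (k : K^o) : U := k *: u.

Lemma tunitl_bil_bilinear : bilinear_for *:%R *:%R tunitl_bil.
Proof.
split=> [u a k k'|k a u u']; rewrite /tunitl_bil.
  by rewrite scalerDl -scalerA.
by rewrite /= scalerDr !scalerA (mulrC k).
Qed.

Lemma tunitr_bil_bilinear : bilinear_for *:%R *:%R tunitr_bil.
Proof.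
case: tunitl_bil_bilinear => linl linr.
by split=> [k|u]; [exact: linr | exact: linl].
Qed.

HB.instance Definition _ := bilinear_isBilinear.Build K K^o U U *:%R *:%R
  tunitl_bil tunitl_bil_bilinear.
HB.instance Definition _ := bilinear_isBilinear.Build K U K^o U *:%R *:%R
  tunitr_bil tunitr_bil_bilinear.

Definition tunitl : tensor K^o U -> U := tlift tunitl_bil.
Definition tunitr : tensor U K^o -> U := tlift tunitr_bil.
HB.instance Definition _ := GRing.Linear.on tunitl.
HB.instance Definition _ := GRing.Linear.on tunitr.

Lemma tunitlE k u : tunitl (k \ot u) = k *: u.
Proof. exact: tliftE. Qed.

Lemma tunitrE u k : tunitr (u \ot k) = k *: u.
Proof. exact: tliftE. Qed.

End Units.
End TensorMaps.

Notation "f \otm g" := (tmap f g) (at level 40, left associativity) : ring_scope.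

Section HomAlgebra.
Variable K : fieldType.

(* The operations only; the axioms are in unital_hom_associative. *)
Record hom_alg (A : lmodType K) := HomAlg {
  hmul : {linear tensor A A -> A};
  htwist : {linear A -> A};
  hone : A
}.

Definition hprod (A : lmodType K) (H : hom_alg A) (x y : A) : A :=
  hmul H (x \ot y).

Definition unital_hom_associative (A : lmodType K) (H : hom_alg A) : Prop :=
  (forall x y z,
     hprod H (hprod H x y) (htwist H z) = hprod H (htwist H x) (hprod H y z))
  /\ (forall x, hprod H x (hone H) = htwist H x
                /\ hprod H (hone H) x = htwist H x).

(* Morphisms preserve units, so below Delta 1 = 1 (x) 1 and eps 1 = 1; together
   with counitality these give alpha 1 = 1. *)
Definition hom_alg_morphism (A B : lmodType K) (HA : hom_alg A) (HB : hom_alg B)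
    (f : {linear A -> B}) : Prop :=
  [/\ forall x, f (htwist HA x) = htwist HB (f x),
      forall x y, f (hprod HA x y) = hprod HB (f x) (f y)
    & f (hone HA) = hone HB].

Definition hom_invertible (A : lmodType K) (H : hom_alg A) (x : A) : Prop :=
  exists y, hprod H x y = hone H /\ hprod H y x = hone H.

Definition field_hom_alg : hom_alg K^o := HomAlg (@tunitl K K^o) idfun 1.

Definition tensor_hom_alg (A B : lmodType K) (HA : hom_alg A) (HB : hom_alg B) :
    hom_alg (tensor A B) :=
  HomAlg ((hmul HA \otm hmul HB) \o @tinter K A B A B)
         (htwist HA \otm htwist HB) (hone HA \ot hone HB).

Lemma field_hprodE (k l : K^o) : hprod field_hom_alg k l = k * l.
Proof. exact: tunitlE. Qed.

Lemma tensor_hprodE (A B : lmodType K) (HA : hom_alg A) (HB : hom_alg B) a b c d :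
  hprod (tensor_hom_alg HA HB) (a \ot b) (c \ot d) = hprod HA a c \ot hprod HB b d.
Proof. by rewrite /hprod /= tinterE tmapE. Qed.

End HomAlgebra.

(* Tensor powers are bracketed to the right: A^(x)3 is A (x) (A (x) A), and so on. *)
Notation tensor2 A := (tensor A A).
Notation tensor3 A := (tensor A (tensor2 A)).
Notation tensor4 A := (tensor A (tensor3 A)).

Section HQBialgebra.
Variable K : fieldType.

Record hq_data (A : lmodType K) := HQData {
  hq_mu : {linear tensor2 A -> A};
  hq_eta : {linear K^o -> A};
  hq_Delta : {linear A -> tensor2 A};
  hq_eps : {linear A -> K^o};
  hq_alpha : {linear A -> A};
  hq_Phi : tensor3 A
}.

Section Def.
Variables (A : lmodType K) (H : hq_data A).
Local Notation Delta := (hq_Delta H).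
Local Notation eps := (hq_eps H).
Local Notation alpha := (hq_alpha H).
Local Notation Phi := (hq_Phi H).

Definition hq_one : A := hq_eta H 1.

Definition hq_alg1 : hom_alg A := HomAlg (hq_mu H) alpha hq_one.
Definition hq_alg2 : hom_alg (tensor2 A) := tensor_hom_alg hq_alg1 hq_alg1.
Definition hq_alg3 : hom_alg (tensor3 A) := tensor_hom_alg hq_alg1 hq_alg2.
Definition hq_alg4 : hom_alg (tensor4 A) := tensor_hom_alg hq_alg1 hq_alg3.

Definition hq_Delta_alpha : tensor2 A -> tensor3 A :=
  @tassoc K A A A \o (Delta \otm alpha).
HB.instance Definition _ := GRing.Linear.on hq_Delta_alpha.

Definition hq_Phi123 : tensor4 A :=
  (idfun \otm @tassoc K A A A) (tassoc (Phi \ot hq_one)).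
Definition hq_Phi234 : tensor4 A := hq_one \ot Phi.

Definition hq_coassociative : Prop := forall x : A,
  hprod hq_alg3 ((alpha \otm Delta) (Delta x)) Phi
  = hprod hq_alg3 Phi (hq_Delta_alpha (Delta x)).

Definition hq_counital : Prop := forall x : A,
  tunitl ((eps \otm idfun) (Delta x)) = alpha x
  /\ tunitr ((idfun \otm eps) (Delta x)) = alpha x.

(* The triple product on the right is bracketed to the left; the other bracketing
   agrees by Hom-associativity, since alpha^(x)3 Phi = Phi and alpha 1 = 1. *)
Definition hq_pentagon : Prop :=
  hprod hq_alg4 ((alpha \otm (alpha \otm Delta)) Phi)
                (tassoc ((Delta \otm (alpha \otm alpha)) Phi))
  = hprod hq_alg4 (hprod hq_alg4 hq_Phi234 ((alpha \otm hq_Delta_alpha) Phi))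
                  hq_Phi123.

Definition hq_counit_Phi : Prop :=
  (idfun \otm @tunitl K A) ((idfun \otm (eps \otm idfun)) Phi)
  = hq_one \ot hq_one.

Record HQ_bialgebra : Prop := {
  HQ_Phi_invertible : hom_invertible hq_alg3 Phi;
  HQ_Phi_twist : (alpha \otm (alpha \otm alpha)) Phi = Phi;
  HQ_algebra : unital_hom_associative hq_alg1;
  HQ_Delta_morphism : hom_alg_morphism hq_alg1 hq_alg2 Delta;
  HQ_eps_morphism : hom_alg_morphism hq_alg1 (field_hom_alg K) eps;
  HQ_coassociative : hq_coassociative;
  HQ_counital : hq_counital;
  HQ_pentagon : hq_pentagon;
  HQ_counit_Phi : hq_counit_Phi
}.

End Def.

Definition HQ_bialgebra_morphism (A A' : lmodType K) (H : hq_data A)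
    (H' : hq_data A') (f : {linear A -> A'}) : Prop :=
  [/\ forall x, f (hq_mu H x) = hq_mu H' ((f \otm f) x),
      f (hq_one H) = hq_one H'
    & forall x, (f \otm f) (hq_Delta H x) = hq_Delta H' (f x)] /\
  [/\ forall x, hq_eps H' (f x) = hq_eps H x,
      forall x, f (hq_alpha H x) = hq_alpha H' (f x)
    & (f \otm (f \otm f)) (hq_Phi H) = hq_Phi H'].

Definition quasi_data (A : lmodType K) (mu : {linear tensor2 A -> A})
    (eta : {linear K^o -> A}) (Delta : {linear A -> tensor2 A})
    (eps : {linear A -> K^o}) (Phi : tensor3 A) : hq_data A :=
  HQData mu eta Delta eps idfun Phi.

End HQBialgebra.

(* Main.v *)
Require Import Defs.
From HB Require Import structures.
From mathcomp Require Import all_boot all_algebra.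

Import GRing.Theory.
Local Open Scope ring_scope.

(** Every tensor power of [beta] is multiplicative, and each new product is the
    old one followed by that tensor power.  Since [beta] commutes with [alpha] and
    [Delta], the factors [beta] in the new twist and comultiplication can be moved
    to the right, where the tensor power of [beta] fixes [Phi] or is absorbed in
    the argument of [Delta]; the remaining ones come from the products, and one
    level too many of them in the pentagon disappears because the factors built
    from [Phi] are fixed as well. *)

(** Bundled linear maps that agree pointwise need not be convertible, so after [tmap_comp]
    composites such as [beta \o alpha] and [alpha \o beta] are exchanged through this lemma. *)
Lemma eq_tmap (K : fieldType) (U V U' V' : lmodType K)
    (f f' : {linear U -> U'}) (g g' : {linear V -> V'}) :
  f =1 f' -> g =1 g' -> f \otm g =1 f' \otm g'.
Proof. by move=> ff gg; apply: tensor_ext => u v; rewrite /= !tmapE ff gg. Qed.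

Lemma tmap_comp (K : fieldType) (U V U1 V1 U2 V2 : lmodType K)
    (f : {linear U -> U1}) (g : {linear V -> V1})
    (f' : {linear U1 -> U2}) (g' : {linear V1 -> V2}) x :
  (f' \otm g') ((f \otm g) x) = ((f' \o f) \otm (g' \o g)) x.
Proof.
apply: (@tensor_ext _ _ _ _ ((f' \otm g') \o (f \otm g))
  ((f' \o f) \otm (g' \o g))) => u v.
by rewrite /= !tmapE.
Qed.

(** [hq_Delta_alpha] contains a rebracketing, which tensor powers of [beta] have to cross. *)
Lemma tassoc_natural (K : fieldType) (U V W U' V' W' : lmodType K)
    (f : {linear U -> U'}) (g : {linear V -> V'}) (h : {linear W -> W'}) x :
  tassoc (((f \otm g) \otm h) x) = (f \otm (g \otm h)) (tassoc x).
Proof.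
elim/tensor_ind: x => [|x w|x y IHx IHy]; first by rewrite !linear0.
  elim/tensor_ind: x => [|u v|x y IHx IHy]; first by rewrite linear0l !linear0.
    by rewrite tassocE !tmapE /= !tmapE tassocE.
  by rewrite linearDl !linearD /= IHx IHy.
by rewrite !linearD /= IHx IHy.
Qed.

Definition multiplicative {K : fieldType} {A : lmodType K} (H : hom_alg A)
    (b : {linear A -> A}) : Prop :=
  forall x y, b (hprod H x y) = hprod H (b x) (b y).

(** Yau's twist of a product. Only the products are compared; the twist map and unit of [H'] are
    left free. *)
Definition twisted_product {K : fieldType} {A : lmodType K} (H H' : hom_alg A)
    (b : {linear A -> A}) : Prop :=
  forall x y, hprod H' x y = b (hprod H x y).

Section HomAlgebraProducts.
Variable K : fieldType.

Lemma hprod0l (A : lmodType K) (H : hom_alg A) x : hprod H 0 x = 0.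
Proof. by rewrite /hprod linear0l linear0. Qed.

Lemma hprod0r (A : lmodType K) (H : hom_alg A) x : hprod H x 0 = 0.
Proof. by rewrite /hprod !linear0. Qed.

Lemma hprodDl (A : lmodType K) (H : hom_alg A) x y z :
  hprod H (x + y) z = hprod H x z + hprod H y z.
Proof. by rewrite /hprod linearDl linearD. Qed.

Lemma hprodDr (A : lmodType K) (H : hom_alg A) x y z :
  hprod H z (x + y) = hprod H z x + hprod H z y.
Proof. by rewrite /hprod !linearD. Qed.

Variables A B : lmodType K.

(** Both sides are bilinear in [x] and [y], so pure tensors suffice, and there the product is
    componentwise. *)
Lemma multiplicative_tensor (HA : hom_alg A) (HB : hom_alg B)
    (b : {linear A -> A}) (c : {linear B -> B}) :
  multiplicative HA b -> multiplicative HB c ->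
  multiplicative (tensor_hom_alg HA HB) (b \otm c).
Proof.
move=> bM cM x y.
elim/tensor_ind: x => [|u v|x x' IH IH'].
- by rewrite !(linear0, hprod0l).
- elim/tensor_ind: y => [|u' v'|y y' IH IH'].
  + by rewrite !(linear0, hprod0r).
  + by rewrite /= tensor_hprodE !tmapE tensor_hprodE bM cM.
  + by rewrite hprodDr !linearD /= IH IH' hprodDr.
- by rewrite hprodDl !linearD /= IH IH' hprodDl.
Qed.

Lemma twisted_product_tensor (HA HA' : hom_alg A) (HB HB' : hom_alg B)
    (b : {linear A -> A}) (c : {linear B -> B}) :
  twisted_product HA HA' b -> twisted_product HB HB' c ->
  twisted_product (tensor_hom_alg HA HB) (tensor_hom_alg HA' HB') (b \otm c).
Proof.
move=> bM cM x y.
elim/tensor_ind: x => [|u v|x x' IH IH'].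
- by rewrite !(hprod0l, linear0).
- elim/tensor_ind: y => [|u' v'|y y' IH IH'].
  + by rewrite !(hprod0r, linear0).
  + by rewrite /= !tensor_hprodE tmapE bM cM.
  + by rewrite !hprodDr linearD /= IH IH'.
- by rewrite !hprodDl linearD /= IH IH'.
Qed.

End HomAlgebraProducts.

(* The twist [alpha'] is only pointwise equal to [beta \o alpha], so that for
   [alpha = id] it can be [beta] itself, which as a bundled linear map is not
   convertible to [beta \o idfun]. *)
Lemma HQ_bialgebra_twist (K : fieldType) (A : lmodType K)
    (mu : {linear tensor2 A -> A}) (eta : {linear K^o -> A})
    (Delta : {linear A -> tensor2 A}) (eps : {linear A -> K^o})
    (alpha alpha' : {linear A -> A}) (Phi : tensor3 A) (beta : {linear A -> A}) :
  (forall x, alpha' x = beta (alpha x)) ->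
  HQ_bialgebra (HQData mu eta Delta eps alpha Phi) ->
  HQ_bialgebra_morphism (HQData mu eta Delta eps alpha Phi)
    (HQData mu eta Delta eps alpha Phi) beta ->
  HQ_bialgebra (HQData (beta \o mu) eta (Delta \o beta) eps alpha' Phi).
Proof.
set H := HQData mu eta Delta eps alpha Phi => alpha'E.
set H' := HQData _ _ _ _ alpha' _.
move=> [PhiV /= PhiT [mulA mul1] [/= DT DM D1] [/= eT eM e1] coA coU pent ePhi].
move=> [[/= bmu b1 bD] [/= beps balpha bPhi]].
rewrite /hq_one /= in b1 D1 e1 *.
set b2 : {linear tensor2 A -> tensor2 A} := beta \otm beta.
set b3 : {linear tensor3 A -> tensor3 A} := beta \otm b2.
set b4 : {linear tensor4 A -> tensor4 A} := beta \otm b3.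
have {}bD x : b2 (Delta x) = Delta (beta x) by exact: bD.
have {}bPhi : b3 Phi = Phi by exact: bPhi.
have M1 : multiplicative (hq_alg1 H) beta.
  by move=> x y; rewrite /hprod /= bmu tmapE.
have M4 : multiplicative (hq_alg4 H) b4 by do 3!apply: multiplicative_tensor => //.
have T1 : twisted_product (hq_alg1 H) (hq_alg1 H') beta by [].
have T2 : twisted_product (hq_alg2 H) (hq_alg2 H') b2.
  exact: twisted_product_tensor.
have T3 : twisted_product (hq_alg3 H) (hq_alg3 H') b3.
  exact: twisted_product_tensor.
have T4 : twisted_product (hq_alg4 H) (hq_alg4 H') b4.
  exact: twisted_product_tensor.
have alpha'C x : alpha' x = alpha (beta x) by rewrite alpha'E balpha.
have alpha2 t : (alpha' \otm alpha') t = (alpha \otm alpha) (b2 t).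
  by rewrite tmap_comp; exact: eq_tmap.
have alphaD t : (alpha' \otm (Delta \o beta)) t = (alpha \otm Delta) (b2 t).
  by rewrite tmap_comp; exact: eq_tmap.
have Dalpha t : hq_Delta_alpha H' t = hq_Delta_alpha H (b2 t).
  by rewrite /hq_Delta_alpha /= tmap_comp; congr tassoc; exact: eq_tmap.
have b3Dalpha t : b3 (hq_Delta_alpha H t) = hq_Delta_alpha H (b2 t).
  rewrite /hq_Delta_alpha /= -tassoc_natural !tmap_comp; congr tassoc.
  exact: eq_tmap.
split; rewrite /hq_coassociative /hq_counital /hq_pentagon /=.
(* The old inverse still works: the new products are [b3] of the old ones, and [b3] fixes the
   unit. *)
- have [y [Py yP]] := PhiV; exists y.
  by rewrite !T3 Py yP /= tmapE /= tmapE /hq_one /= b1.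
- rewrite -[RHS]PhiT -[in RHS]bPhi tmap_comp.
  exact: eq_tmap.
- split=> [x y z|x].
    (* By multiplicativity, each side is [beta] applied twice to the corresponding old side. *)
    by rewrite /= !T1 !alpha'E -!M1 mulA.
  have [mulx1 mul1x] := mul1 x.
  by rewrite !T1 alpha'E mulx1 mul1x.
- split=> [x|x y|] /=; last by rewrite /hq_one /= b1 D1.
    by rewrite alpha'C balpha DT alpha2 bD.
  by rewrite T1 T2 M1 -bD DM.
- split=> [x|x y|] //=; first by rewrite alpha'E beps eT.
  by rewrite T1 beps eM.
(* This is [b3] of the old axiom at [beta (beta x)]: one [beta] comes from the new [Delta (beta x)],
   the other from the maps applied to it. *)
- by move=> x; rewrite !T3 alphaD Dalpha bD coA.
- by move=> x; rewrite alpha'C; exact: coU.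
- rewrite !T4.
  have -> : (alpha' \otm (alpha' \otm (Delta \o beta))) Phi
      = (alpha \otm (alpha \otm Delta)) Phi.
    by rewrite -[in RHS]bPhi tmap_comp; exact: eq_tmap.
  have -> : ((Delta \o beta) \otm (alpha' \otm alpha')) Phi
      = (Delta \otm (alpha \otm alpha)) Phi.
    by rewrite -[in RHS]bPhi tmap_comp; exact: eq_tmap.
  have -> : (alpha' \otm hq_Delta_alpha H') Phi
      = (alpha \otm hq_Delta_alpha H) Phi.
    by rewrite -[in RHS]bPhi tmap_comp; exact: eq_tmap.
  have Phi234 : b4 (hq_Phi234 H) = hq_Phi234 H.
    by rewrite [LHS]tmapE bPhi /hq_one /= b1.
  (* Since [beta] commutes with [alpha] and [b3Dalpha] holds, [b4] moves inside as [b3], which fixes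
     [Phi]. *)
  have aDalphaPhi : b4 ((alpha \otm hq_Delta_alpha H) Phi)
      = (alpha \otm hq_Delta_alpha H) Phi.
    by rewrite -[in RHS]bPhi [LHS]tmap_comp [RHS]tmap_comp; exact: eq_tmap.
  (* The triple product has an extra [b4] on its inner product; [M4] distributes it over two factors
     that it fixes. *)
  by rewrite pent; congr (b4 (hprod _ _ _)); rewrite M4 Phi234 aDalphaPhi.
- exact: ePhi.
Qed.

Theorem theorem3p5 (K : fieldType) (A : lmodType K)
    (mu : {linear tensor2 A -> A}) (eta : {linear K^o -> A})
    (Delta : {linear A -> tensor2 A}) (eps : {linear A -> K^o})
    (Phi : tensor3 A) (beta : {linear A -> A}) :
  (forall alpha : {linear A -> A},
     HQ_bialgebra (HQData mu eta Delta eps alpha Phi) ->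
     HQ_bialgebra_morphism (HQData mu eta Delta eps alpha Phi)
       (HQData mu eta Delta eps alpha Phi) beta ->
     HQ_bialgebra
       (HQData (beta \o mu) eta (Delta \o beta) eps (beta \o alpha) Phi))
  /\
  (HQ_bialgebra (quasi_data mu eta Delta eps Phi) ->
   HQ_bialgebra_morphism (quasi_data mu eta Delta eps Phi)
     (quasi_data mu eta Delta eps Phi) beta ->
   HQ_bialgebra (HQData (beta \o mu) eta (Delta \o beta) eps beta Phi)).
Proof. by split=> [alpha|]; exact: HQ_bialgebra_twist. Qed.
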